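(* Let $\mathbb{X}$ be a Cartesian difference category with infinitesimal extension $\varepsilon$ and difference combinator $\boldsymbol\partial$. Define $\alpha:\mathbb{X}\to\mathsf{CAct}(\mathbb{X})$ on objects by $\alpha(A)=(A,A,\oplus_A,+_A,0_A)$, where $\oplus_A=\pi_0+\varepsilon(\pi_1):A\times A\to A$, $+_A=\pi_0+\pi_1:A\times A\to A$ and $0_A=0:\top\to A$, and on maps by $\alpha(f)=(f,\boldsymbol\partial[f])$. Then $\alpha$ is a well-defined functor and $(\mathbb{X},\alpha:\mathbb{X}\to\mathsf{CAct}(\mathbb{X}))$ is a change action model.
   Context: Composition is written $g\circ f$ (first $f$, then $g$). A Cartesian category is a category with chosen finite products: binary products $A\times B$ with projections $\pi_0,\pi_1$, pairing $\langle -,-\rangle$, $f\times g=\langle f\circ\pi_0,g\circ\pi_1\rangle$, and terminal object $\top$ with unique maps $!_A:A\to\top$. A left additive category is a category in which each hom-set is a commutative monoid $(+,0)$ with $(f+g)\circ h=f\circ h+g\circ h$ and $0\circ f=0$. A map $k$ is additive if $k\circ(f+g)=k\circ f+k\circ g$ and $k\circ 0=0$. A Cartesian left additive category is a Cartesian category that is also left additive and whose projections are all additive. An infinitesimal extension $\varepsilon$ on a Cartesian left additive category $\mathbb{X}$ consists of functions $\varepsilon:\mathbb{X}(A,B)\to\mathbb{X}(A,B)$ for all $A,B$ such that [E.1] $\varepsilon(f+g)=\varepsilon(f)+\varepsilon(g)$, $\varepsilon(0)=0$; [E.2] $\varepsilon(g\circ f)=\varepsilon(g)\circ f$; [E.3]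 $\varepsilon(\pi_i)=\pi_i\circ\varepsilon(1_{A\times B})$ for $i=0,1$. A Cartesian difference category is a Cartesian left additive category with an infinitesimal extension $\varepsilon$ and a difference combinator $\boldsymbol\partial$, assigning to each $f:A\to B$ a map $\boldsymbol\partial[f]:A\times A\to B$, such that (for all suitable maps): [C∂.0] $f\circ(x+\varepsilon(y))=f\circ x+\varepsilon(\boldsymbol\partial[f]\circ\langle x,y\rangle)$; [C∂.1] $\boldsymbol\partial[f+g]=\boldsymbol\partial[f]+\boldsymbol\partial[g]$, $\boldsymbol\partial[0]=0$, $\boldsymbol\partial[\varepsilon(f)]=\varepsilon(\boldsymbol\partial[f])$; [C∂.2] $\boldsymbol\partial[f]\circ\langle x,y+z\rangle=\boldsymbol\partial[f]\circ\langle x,y\rangle+\boldsymbol\partial[f]\circ\langle x+\varepsilon(y),z\rangle$, $\boldsymbol\partial[f]\circ\langle x,0\rangle=0$; [C∂.3] $\boldsymbol\partial[1_A]=\pi_1$, $\boldsymbol\partial[\pi_0]=\pi_0\circ\pi_1$, $\boldsymbol\partial[\pi_1]=\pi_1\circ\pi_1$; [C∂.4] $\boldsymbol\partial[\langle f,g\rangle]=\langle\boldsymbol\partial[f],\boldsymbol\partial[g]\rangle$; [C∂.5] $\boldsymbol\partial[g\circ f]=\boldsymbol\partial[g]\circ\langle f\circ\pi_0,\boldsymbol\partial[f]\rangle$; [C∂.6] $\boldsymbol\partial[\boldsymbol\partial[f]]\circ\langle\langle x,y\rangle,\langle 0,z\rangle\rangle=\boldsymbol\partial[f]\circ\langle x+\varepsilon(y),z\rangle$;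 [C∂.7] $\boldsymbol\partial[\boldsymbol\partial[f]]\circ\langle\langle x,y\rangle,\langle z,0\rangle\rangle=\boldsymbol\partial[\boldsymbol\partial[f]]\circ\langle\langle x,z\rangle,\langle y,0\rangle\rangle$. A change action in a Cartesian category $\mathbb{X}$ is a quintuple $(A,\Delta A,\oplus_A,+_A,0_A)$ with objects $A,\Delta A$ and maps $\oplus_A:A\times\Delta A\to A$, $+_A:\Delta A\times\Delta A\to\Delta A$, $0_A:\top\to\Delta A$ such that $(\Delta A,+_A,0_A)$ is an internal monoid (not necessarily commutative) and $\oplus_A$ is an action of it on $A$: $\oplus_A\circ\langle 1_A,0_A\circ !_A\rangle=1_A$ and $\oplus_A\circ(1_A\times +_A)=\oplus_A\circ\langle\oplus_A\circ(1_A\times\pi_0),\pi_1\circ\pi_1\rangle$. For maps write $f\oplus_A g=\oplus_A\circ\langle f,g\rangle$ and $h+_A k=+_A\circ\langle h,k\rangle$. Given change actions on $A$ and $B$, a derivative of $f:A\to B$ is a map $\boldsymbol\partial[f]:A\times\Delta A\to\Delta B$ such that for all $x:C\to A$ and $y,z:C\to\Delta A$: [CAD.1] $f\circ(x\oplus_A y)=(f\circ x)\oplus_B(\boldsymbol\partial[f]\circ\langle x,y\rangle)$; [CAD.2] $\boldsymbol\partial[f]\circ\langle x,y+_A z\rangle=(\boldsymbol\partial[f]\circ\langle x,y\rangle)+_B(\boldsymbol\partial[f]\circ\langle x\oplus_A y,z\rangle)$ and $\boldsymbol\partial[f]\circ\langle x,0_A\circ !_C\rangle=0_B\circ !_C$.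 $\mathsf{CAct}(\mathbb{X})$ is the category whose objects are change actions in $\mathbb{X}$ and whose maps are pairs $(f,\boldsymbol\partial[f])$ with $\boldsymbol\partial[f]$ a derivative of $f$; the identity is $(1_A,\pi_1)$ and $(g,\boldsymbol\partial[g])\circ(f,\boldsymbol\partial[f])=(g\circ f,\boldsymbol\partial[g]\circ\langle f\circ\pi_0,\boldsymbol\partial[f]\rangle)$. It is Cartesian: the product of two change actions has underlying objects $A\times B$ and $\Delta A\times\Delta B$ with componentwise structure, projections $(\pi_i,\pi_i\circ\pi_1)$, and pairing $(\langle f,g\rangle,\langle\boldsymbol\partial[f],\boldsymbol\partial[g]\rangle)$. The forgetful functor $\mathcal{E}:\mathsf{CAct}(\mathbb{X})\to\mathbb{X}$ sends a change action to $A$ and $(f,\boldsymbol\partial[f])$ to $f$. A change action model is a Cartesian category $\mathbb{X}$ with a product-preserving functor $\alpha:\mathbb{X}\to\mathsf{CAct}(\mathbb{X})$ with $\mathcal{E}\circ\alpha=1_{\mathbb{X}}$. *)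

(* Defs.v *)
From mathcomp Require Import ssreflect ssrfun.
From Stdlib Require Import ProofIrrelevance.

Set Implicit Arguments.
Unset Strict Implicit.
Unset Printing Implicit Defensive.

Declare Scope cat_scope.
Delimit Scope cat_scope with cat.
Local Open Scope cat_scope.

Record category := Category {
  obj :> Type;
  hom : obj -> obj -> Type;
  idm : forall A, hom A A;
  comp : forall A B C, hom B C -> hom A B -> hom A C;
  comp1m : forall A B (f : hom A B), comp (idm B) f = f;
  compm1 : forall A B (f : hom A B), comp f (idm A) = f;
  compmA : forall A B C D (h : hom C D) (g : hom B C) (f : hom A B),
    comp (comp h g) f = comp h (comp g f) }.

Arguments hom {c} A B.
Arguments idm {c} A.
Arguments comp {c A B C} g f : rename.

Notation "g ∘ f" := (comp g f) (at level 40, left associativity) : cat_scope.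

Record functor_data (C D : category) := FunctorData {
  fobj :> C -> D;
  fmap : forall A B : C, hom A B -> hom (fobj A) (fobj B) }.

Arguments fmap {C D} F {A B} f : rename.

Record is_functor (C D : category) (F : functor_data C D) : Prop := IsFunctor {
  fmap1 : forall A : C, fmap F (idm A) = idm (F A);
  fmapM : forall (A B E : C) (g : hom B E) (f : hom A B),
    fmap F (g ∘ f) = fmap F g ∘ fmap F f }.

Record functor (C D : category) := Functor {
  functor_of :> functor_data C D;
  functorP : is_functor functor_of }.

Definition functor_id_data (C : category) : functor_data C C :=
  FunctorData (fun (A B : C) (f : hom A B) => f).

Lemma functor_id_subproof (C : category) : is_functor (functor_id_data C).
Proof. by []. Qed.

Definition functor_id (C : category) : functor C C :=
  Functor (functor_id_subproof C).

Definition functor_comp_data (C D E : category)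
    (G : functor D E) (F : functor C D) : functor_data C E :=
  FunctorData (fun (A B : C) (f : hom A B) => fmap G (fmap F f)).

Lemma functor_comp_subproof (C D E : category)
    (G : functor D E) (F : functor C D) : is_functor (functor_comp_data G F).
Proof.
split=> [A|A B B' g f] /=.
  by rewrite (fmap1 (functorP F)) (fmap1 (functorP G)).
by rewrite (fmapM (functorP F)) (fmapM (functorP G)).
Qed.

Definition functor_comp (C D E : category)
    (G : functor D E) (F : functor C D) : functor C E :=
  Functor (functor_comp_subproof G F).

Record cartesian_category := CartesianCategory {
  cart_cat :> category;
  prod_obj : cart_cat -> cart_cat -> cart_cat;
  prj0 : forall A B, hom (prod_obj A B) A;
  prj1 : forall A B, hom (prod_obj A B) B;
  pairing : forall C A B, hom C A -> hom C B -> hom C (prod_obj A B);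
  proj0_pair : forall C A B (f : hom C A) (g : hom C B),
    prj0 A B ∘ pairing f g = f;
  proj1_pair : forall C A B (f : hom C A) (g : hom C B),
    prj1 A B ∘ pairing f g = g;
  pair_eta : forall C A B (h : hom C (prod_obj A B)),
    pairing (prj0 A B ∘ h) (prj1 A B ∘ h) = h;
  top_obj : cart_cat;
  bang : forall A, hom A top_obj;
  bang_unique : forall A (f : hom A top_obj), f = bang A }.

Arguments prod_obj {c} A B.
Arguments prj0 {c A B}.
Arguments prj1 {c A B}.
Arguments pairing {c C A B} f g.
Arguments top_obj {c}.
Arguments bang {c} A.

Notation "A × B" := (prod_obj A B) (at level 39, right associativity) : cat_scope.
Notation "⟨ f , g ⟩" := (pairing f g)
  (at level 0, f at level 99, g at level 99, format "⟨ f ,  g ⟩") : cat_scope.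
Notation "⊤" := top_obj (at level 0) : cat_scope.
Notation π0 := prj0.
Notation π1 := prj1.

Definition prod_hom (X : cartesian_category) (A A' B B' : X)
    (f : hom A A') (g : hom B B') : hom (A × B) (A' × B') :=
  ⟨f ∘ π0, g ∘ π1⟩.

Notation "f ×m g" := (prod_hom f g) (at level 39, right associativity) : cat_scope.

Section CartesianTheory.
Variable X : cartesian_category.

Lemma pair_comp (D C A B : X) (f : hom C A) (g : hom C B) (h : hom D C) :
  ⟨f, g⟩ ∘ h = ⟨f ∘ h, g ∘ h⟩.
Proof. by rewrite -[LHS]pair_eta -!compmA proj0_pair proj1_pair. Qed.

Lemma proj0_pairA (D C A B : X) (f : hom C A) (g : hom C B) (h : hom D C) :
  π0 ∘ (⟨f, g⟩ ∘ h) = f ∘ h.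
Proof. by rewrite -compmA proj0_pair. Qed.

Lemma proj1_pairA (D C A B : X) (f : hom C A) (g : hom C B) (h : hom D C) :
  π1 ∘ (⟨f, g⟩ ∘ h) = g ∘ h.
Proof. by rewrite -compmA proj1_pair. Qed.

Lemma bang_comp (A B : X) (f : hom A B) : bang B ∘ f = bang A.
Proof. exact: bang_unique. Qed.

Lemma pair_proj (A B : X) : ⟨π0, π1⟩ = idm (A × B).
Proof. by rewrite -[RHS]pair_eta !compm1. Qed.

Definition catE := (compmA, comp1m, compm1, proj0_pair, proj1_pair,
  proj0_pairA, proj1_pairA, pair_comp, bang_comp).

End CartesianTheory.

(** Products are chosen structure, so preservation is understood strictly: the
  image of the chosen product diagram is the chosen product diagram.  Bundling
  the apex with its two legs lets this be a single Leibniz equality, without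
  transporting morphisms along an equality of objects.  The universal form of
  preservation follows: see [preserves_products_universal] below. *)

Record span (C : category) (A B : C) := Span {
  apex : C;
  leg0 : hom apex A;
  leg1 : hom apex B }.

Definition product_span (C : cartesian_category) (A B : C) : span A B :=
  Span (π0 : hom (A × B) A) π1.

Definition map_span (C D : category) (F : functor C D) (A B : C)
    (s : span A B) : span (F A) (F B) :=
  Span (fmap F (leg0 s)) (fmap F (leg1 s)).

Definition preserves_products (C D : cartesian_category) (F : functor C D) :
    Prop :=
  (forall A B : C, map_span F (product_span A B) = product_span (F A) (F B))
  /\ F ⊤ = ⊤.

Lemma preserves_products_universal (C D : cartesian_category)
    (F : functor C D) : preserves_products F ->
  (forall (A B : C) (E : D) (f : hom E (F A)) (g : hom E (F B)),
     exists! h : hom E (F (A × B)),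
       fmap F (π0 : hom (A × B) A) ∘ h = f /\
       fmap F (π1 : hom (A × B) B) ∘ h = g)
  /\ (forall E : D, exists! h : hom E (F ⊤), True).
Proof.
case=> FP FT; split=> [A B E f g|E]; last first.
  by rewrite FT; exists (bang E); split=> // h _; rewrite [RHS]bang_unique.
change (exists! h : hom E (apex (map_span F (product_span A B))),
  leg0 (map_span F (product_span A B)) ∘ h = f /\
  leg1 (map_span F (product_span A B)) ∘ h = g).
rewrite FP /=; exists ⟨f, g⟩; split=> [|h [<- <-]]; last exact: pair_eta.
by rewrite proj0_pair proj1_pair.
Qed.

Record left_additive_structure (X : category) := LeftAdditiveStructure {
  las_add : forall A B : X, hom A B -> hom A B -> hom A B;
  las_zero : forall A B : X, hom A B;
  las_addA : forall (A B : X) (f g h : hom A B),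
    las_add f (las_add g h) = las_add (las_add f g) h;
  las_addC : forall (A B : X) (f g : hom A B), las_add f g = las_add g f;
  las_add0 : forall (A B : X) (f : hom A B), las_add (las_zero A B) f = f;
  las_add_comp : forall (A B C : X) (f g : hom B C) (h : hom A B),
    las_add f g ∘ h = las_add (f ∘ h) (g ∘ h);
  las_zero_comp : forall (A B C : X) (f : hom A B),
    las_zero B C ∘ f = las_zero A C }.

Definition is_additive (X : category) (L : left_additive_structure X)
    (A B : X) (k : hom A B) : Prop :=
  (forall (C : X) (f g : hom C A),
     k ∘ las_add L f g = las_add L (k ∘ f) (k ∘ g))
  /\ (forall C : X, k ∘ las_zero L C A = las_zero L C B).

Record cartesian_left_additive_category := CartesianLeftAdditiveCategory {
  clac_cart :> cartesian_category;
  clac_add : left_additive_structure clac_cart;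
  clac_proj0 : forall A B : clac_cart,
    is_additive clac_add (π0 : hom (A × B) A);
  clac_proj1 : forall A B : clac_cart,
    is_additive clac_add (π1 : hom (A × B) B) }.

Definition madd (X : cartesian_left_additive_category) (A B : X)
    (f g : hom A B) : hom A B := las_add (clac_add X) f g.
Definition mzero (X : cartesian_left_additive_category) (A B : X) : hom A B :=
  las_zero (clac_add X) A B.

Arguments mzero {X A B}.

Notation "f + g" := (madd f g) : cat_scope.
Notation "0" := mzero : cat_scope.

Record is_infinitesimal_extension (X : cartesian_left_additive_category)
    (eps : forall A B : X, hom A B -> hom A B) : Prop :=
  IsInfinitesimalExtension {
  eps_add : forall (A B : X) (f g : hom A B),
    eps _ _ (f + g) = eps _ _ f + eps _ _ g;
  eps_zero : forall A B : X, eps A B 0 = 0;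
  eps_comp : forall (A B C : X) (g : hom B C) (f : hom A B),
    eps _ _ (g ∘ f) = eps _ _ g ∘ f;
  eps_proj0 : forall A B : X,
    eps _ _ (π0 : hom (A × B) A) = π0 ∘ eps _ _ (idm (A × B));
  eps_proj1 : forall A B : X,
    eps _ _ (π1 : hom (A × B) B) = π1 ∘ eps _ _ (idm (A × B)) }.

Record is_difference_combinator (X : cartesian_left_additive_category)
    (eps : forall A B : X, hom A B -> hom A B)
    (diff : forall A B : X, hom A B -> hom (A × A) B) : Prop :=
  IsDifferenceCombinator {
  diff_taylor : forall (C A B : X) (f : hom A B) (x y : hom C A),
    f ∘ (x + eps _ _ y) = f ∘ x + eps _ _ (diff _ _ f ∘ ⟨x, y⟩);
  diff_add : forall (A B : X) (f g : hom A B),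
    diff _ _ (f + g) = diff _ _ f + diff _ _ g;
  diff_zero : forall A B : X, diff A B 0 = 0;
  diff_eps : forall (A B : X) (f : hom A B),
    diff _ _ (eps _ _ f) = eps _ _ (diff _ _ f);
  diff_regular_add : forall (C A B : X) (f : hom A B) (x y z : hom C A),
    diff _ _ f ∘ ⟨x, y + z⟩ =
    diff _ _ f ∘ ⟨x, y⟩ + diff _ _ f ∘ ⟨x + eps _ _ y, z⟩;
  diff_regular_zero : forall (C A B : X) (f : hom A B) (x : hom C A),
    diff _ _ f ∘ ⟨x, 0⟩ = 0;
  diff_id : forall A : X, diff _ _ (idm A) = π1;
  diff_proj0 : forall A B : X, diff _ _ (π0 : hom (A × B) A) = π0 ∘ π1;
  diff_proj1 : forall A B : X, diff _ _ (π1 : hom (A × B) B) = π1 ∘ π1;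
  diff_pair : forall (C A B : X) (f : hom C A) (g : hom C B),
    diff _ _ ⟨f, g⟩ = ⟨diff _ _ f, diff _ _ g⟩;
  diff_comp : forall (A B C : X) (g : hom B C) (f : hom A B),
    diff _ _ (g ∘ f) = diff _ _ g ∘ ⟨f ∘ π0, diff _ _ f⟩;
  diff_linear : forall (C A B : X) (f : hom A B) (x y z : hom C A),
    diff _ _ (diff _ _ f) ∘ ⟨⟨x, y⟩, ⟨0, z⟩⟩ =
    diff _ _ f ∘ ⟨x + eps _ _ y, z⟩;
  diff_symmetric : forall (C A B : X) (f : hom A B) (x y z : hom C A),
    diff _ _ (diff _ _ f) ∘ ⟨⟨x, y⟩, ⟨z, 0⟩⟩ =
    diff _ _ (diff _ _ f) ∘ ⟨⟨x, z⟩, ⟨y, 0⟩⟩ }.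

Record cartesian_difference_category := CartesianDifferenceCategory {
  cdc_clac :> cartesian_left_additive_category;
  eps : forall A B : cdc_clac, hom A B -> hom A B;
  diff : forall A B : cdc_clac, hom A B -> hom (A × A) B;
  epsP : is_infinitesimal_extension eps;
  diffP : is_difference_combinator eps diff }.

Arguments eps {c A B} f.
Arguments diff {c A B} f.

Section ChangeActions.
Variable X : cartesian_category.

Record change_action_data := ChangeActionData {
  base : X;
  delta : X;
  oplus : hom (base × delta) base;
  dplus : hom (delta × delta) delta;
  dzero : hom ⊤ delta }.

Record is_change_action (P : change_action_data) : Prop := IsChangeAction {
  plus_zero : dplus P ∘ ⟨idm (delta P), dzero P ∘ bang (delta P)⟩ = idm (delta P);
  zero_plus : dplus P ∘ ⟨dzero P ∘ bang (delta P), idm (delta P)⟩ = idm (delta P);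
  plusA : dplus P ∘ (idm (delta P) ×m dplus P) =
          dplus P ∘ ⟨dplus P ∘ (idm (delta P) ×m π0), π1 ∘ π1⟩;
  oplus_zero : oplus P ∘ ⟨idm (base P), dzero P ∘ bang (base P)⟩ = idm (base P);
  oplus_plus : oplus P ∘ (idm (base P) ×m dplus P) =
               oplus P ∘ ⟨oplus P ∘ (idm (base P) ×m π0), π1 ∘ π1⟩ }.

Record change_action := ChangeAction {
  ca_data :> change_action_data;
  ca_dataP : is_change_action ca_data }.

Record is_derivative (P Q : change_action_data) (f : hom (base P) (base Q))
    (df : hom (base P × delta P) (delta Q)) : Prop := IsDerivative {
  deriv_oplus : forall (C : X) (x : hom C (base P)) (y : hom C (delta P)),
    f ∘ (oplus P ∘ ⟨x, y⟩) = oplus Q ∘ ⟨f ∘ x, df ∘ ⟨x, y⟩⟩;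
  deriv_plus : forall (C : X) (x : hom C (base P)) (y z : hom C (delta P)),
    df ∘ ⟨x, dplus P ∘ ⟨y, z⟩⟩ =
    dplus Q ∘ ⟨df ∘ ⟨x, y⟩, df ∘ ⟨oplus P ∘ ⟨x, y⟩, z⟩⟩;
  deriv_zero : forall (C : X) (x : hom C (base P)),
    df ∘ ⟨x, dzero P ∘ bang C⟩ = dzero Q ∘ bang C }.

Arguments is_derivative P Q f df : clear implicits.

Record ca_map (P Q : change_action_data) := CAMap {
  ca_base : hom (base P) (base Q);
  ca_deriv : hom (base P × delta P) (delta Q);
  ca_mapP : is_derivative P Q ca_base ca_deriv }.

Lemma ca_map_eq (P Q : change_action_data) (u v : ca_map P Q) :
  ca_base u = ca_base v -> ca_deriv u = ca_deriv v -> u = v.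
Proof.
case: u v => [f df fP] [g dg gP] /= fg dfg; subst g dg.
by rewrite (proof_irrelevance _ fP gP).
Qed.

Lemma ca_id_subproof (P : change_action_data) :
  is_derivative P P (idm (base P)) π1.
Proof. by split=> *; rewrite !catE. Qed.

Definition ca_id (P : change_action_data) : ca_map P P :=
  CAMap (ca_id_subproof P).

Lemma ca_comp_subproof (P Q R : change_action_data)
    (v : ca_map Q R) (u : ca_map P Q) :
  is_derivative P R (ca_base v ∘ ca_base u)
    (ca_deriv v ∘ ⟨ca_base u ∘ π0, ca_deriv u⟩).
Proof.
case: v u => [g dg [gO gP g0]] [f df [fO fP f0]] /=.
split=> *; rewrite !catE.
- by rewrite fO gO.
- by rewrite fP gP fO.
- by rewrite f0 g0.
Qed.

Definition ca_comp (P Q R : change_action_data)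
    (v : ca_map Q R) (u : ca_map P Q) : ca_map P R :=
  CAMap (ca_comp_subproof v u).

Lemma ca_comp1m (P Q : change_action) (u : ca_map P Q) :
  ca_comp (ca_id Q) u = u.
Proof. by apply: ca_map_eq; rewrite /= !catE. Qed.

Lemma ca_compm1 (P Q : change_action) (u : ca_map P Q) :
  ca_comp u (ca_id P) = u.
Proof. by apply: ca_map_eq; rewrite /= !catE ?pair_proj ?catE. Qed.

Lemma ca_compA (P Q R S : change_action)
    (w : ca_map R S) (v : ca_map Q R) (u : ca_map P Q) :
  ca_comp (ca_comp w v) u = ca_comp w (ca_comp v u).
Proof. by apply: ca_map_eq; rewrite /= !catE. Qed.

Definition CAct_cat : category :=
  @Category change_action (fun P Q => ca_map P Q) (fun P => ca_id P)
    (fun P Q R => @ca_comp P Q R) ca_comp1m ca_compm1 ca_compA.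

Lemma plus_zero_elt (P : change_action) (C : X) (x : hom C (delta P)) :
  dplus P ∘ ⟨x, dzero P ∘ bang C⟩ = x.
Proof.
have := f_equal (fun h => h ∘ x) (plus_zero (ca_dataP P)).
by rewrite !catE.
Qed.

Lemma zero_plus_elt (P : change_action) (C : X) (x : hom C (delta P)) :
  dplus P ∘ ⟨dzero P ∘ bang C, x⟩ = x.
Proof.
have := f_equal (fun h => h ∘ x) (zero_plus (ca_dataP P)).
by rewrite !catE.
Qed.

Lemma plusA_elt (P : change_action) (C : X) (x y z : hom C (delta P)) :
  dplus P ∘ ⟨x, dplus P ∘ ⟨y, z⟩⟩ = dplus P ∘ ⟨dplus P ∘ ⟨x, y⟩, z⟩.
Proof.
have := f_equal (fun h => h ∘ ⟨x, ⟨y, z⟩⟩) (plusA (ca_dataP P)).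
by rewrite /prod_hom !catE.
Qed.

Lemma oplus_zero_elt (P : change_action) (C : X) (x : hom C (base P)) :
  oplus P ∘ ⟨x, dzero P ∘ bang C⟩ = x.
Proof.
have := f_equal (fun h => h ∘ x) (oplus_zero (ca_dataP P)).
by rewrite !catE.
Qed.

Lemma oplus_plus_elt (P : change_action) (C : X) (x : hom C (base P))
    (y z : hom C (delta P)) :
  oplus P ∘ ⟨x, dplus P ∘ ⟨y, z⟩⟩ = oplus P ∘ ⟨oplus P ∘ ⟨x, y⟩, z⟩.
Proof.
have := f_equal (fun h => h ∘ ⟨x, ⟨y, z⟩⟩) (oplus_plus (ca_dataP P)).
by rewrite /prod_hom !catE.
Qed.

Definition ca_eltE :=
  (plus_zero_elt, zero_plus_elt, plusA_elt, oplus_zero_elt, oplus_plus_elt).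

Definition ca_prod_data (P Q : change_action_data) : change_action_data :=
  @ChangeActionData (base P × base Q) (delta P × delta Q)
    ⟨oplus P ∘ (π0 ×m π0), oplus Q ∘ (π1 ×m π1)⟩
    ⟨dplus P ∘ (π0 ×m π0), dplus Q ∘ (π1 ×m π1)⟩
    ⟨dzero P, dzero Q⟩.

Lemma ca_prod_subproof (P Q : change_action) :
  is_change_action (ca_prod_data P Q).
Proof.
by split; rewrite /= /prod_hom !catE ?ca_eltE ?pair_proj.
Qed.

Definition ca_prod (P Q : change_action) : change_action :=
  ChangeAction (ca_prod_subproof P Q).

Lemma ca_proj0_subproof (P Q : change_action) :
  is_derivative (ca_prod P Q) P π0 (π0 ∘ π1).
Proof. by split=> *; rewrite /= /prod_hom !catE. Qed.

Lemma ca_proj1_subproof (P Q : change_action) :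
  is_derivative (ca_prod P Q) Q π1 (π1 ∘ π1).
Proof. by split=> *; rewrite /= /prod_hom !catE. Qed.

Lemma ca_pair_subproof (R P Q : change_action)
    (u : ca_map R P) (v : ca_map R Q) :
  is_derivative R (ca_prod P Q)
    ⟨ca_base u, ca_base v⟩ ⟨ca_deriv u, ca_deriv v⟩.
Proof.
case: u v => [g dg [gO gP g0]] [f df [fO fP f0]] /=.
by split=> *; rewrite /= /prod_hom !catE ?(gO, gP, g0) ?(fO, fP, f0).
Qed.

Definition ca_top_data : change_action_data :=
  @ChangeActionData ⊤ ⊤ (bang (⊤ × ⊤)) (bang (⊤ × ⊤)) (bang ⊤).

Lemma ca_top_subproof : is_change_action ca_top_data.
Proof. by split; rewrite [LHS]bang_unique [RHS]bang_unique. Qed.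

Definition ca_top : change_action := ChangeAction ca_top_subproof.

Lemma ca_bang_subproof (P : change_action) :
  is_derivative P ca_top (bang (base P))
    (bang (base P × delta P)).
Proof. by split=> *; rewrite [LHS]bang_unique [RHS]bang_unique. Qed.

Lemma ca_proj0_pair (R P Q : change_action)
    (u : ca_map R P) (v : ca_map R Q) :
  ca_comp (CAMap (ca_proj0_subproof P Q)) (CAMap (ca_pair_subproof u v)) = u.
Proof. by apply: ca_map_eq; rewrite /= !catE. Qed.

Lemma ca_proj1_pair (R P Q : change_action)
    (u : ca_map R P) (v : ca_map R Q) :
  ca_comp (CAMap (ca_proj1_subproof P Q)) (CAMap (ca_pair_subproof u v)) = v.
Proof. by apply: ca_map_eq; rewrite /= !catE. Qed.

Lemma ca_pair_eta (R P Q : change_action) (w : ca_map R (ca_prod P Q)) :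
  CAMap (ca_pair_subproof
    (ca_comp (CAMap (ca_proj0_subproof P Q)) w)
    (ca_comp (CAMap (ca_proj1_subproof P Q)) w)) = w.
Proof. by apply: ca_map_eq; rewrite /= ?catE pair_eta. Qed.

Lemma ca_bang_unique (P : change_action) (u : ca_map P ca_top) :
  u = CAMap (ca_bang_subproof P).
Proof. by apply: ca_map_eq; rewrite [LHS]bang_unique [RHS]bang_unique. Qed.

Definition CAct : cartesian_category :=
  @CartesianCategory CAct_cat
    (fun P Q => ca_prod P Q)
    (fun P Q => CAMap (ca_proj0_subproof P Q))
    (fun P Q => CAMap (ca_proj1_subproof P Q))
    (fun R P Q u v => CAMap (ca_pair_subproof u v))
    ca_proj0_pair ca_proj1_pair ca_pair_eta
    ca_top (fun P => CAMap (ca_bang_subproof P)) ca_bang_unique.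

Definition forgetful_data : functor_data CAct X :=
  @FunctorData CAct X (fun P : change_action => base P)
    (fun (P Q : change_action) (u : ca_map P Q) => ca_base u).

Lemma forgetful_subproof : is_functor forgetful_data.
Proof. by []. Qed.

Definition forgetful : functor CAct X := Functor forgetful_subproof.

Definition is_change_action_model (alpha : functor X CAct) : Prop :=
  preserves_products alpha /\ functor_comp forgetful alpha = functor_id X.

End ChangeActions.

Arguments is_derivative {X} P Q f df.

Section Alpha.
Variable X : cartesian_difference_category.

Definition alpha_obj (A : X) : change_action_data X :=
  @ChangeActionData X A A (π0 + eps π1) (π0 + π1) 0.

Definition alpha_data
    (obj_ok : forall A : X, is_change_action (alpha_obj A))
    (map_ok : forall (A B : X) (f : hom A B),
       is_derivative (alpha_obj A) (alpha_obj B) f (diff f)) :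
    functor_data X (CAct X) :=
  @FunctorData X (CAct X) (fun A => ChangeAction (obj_ok A))
    (fun A B f => CAMap (map_ok A B f)).

End Alpha.

(* Main.v *)
From mathcomp Require Import ssreflect ssrfun.
From Stdlib Require Import ProofIrrelevance.
Require Import Defs.

Set Implicit Arguments.
Unset Strict Implicit.
Unset Printing Implicit Defensive.

Local Open Scope cat_scope.

(** Reading x ⊕ y as x + ε(y), each requirement on the model becomes an axiom already at hand. The
    change action laws ([alpha_obj_ok]) are the commutative monoid laws and additivity of ε; the
    derivative laws ([alpha_map_ok]) are the Taylor formula [C∂.0] and regularity [C∂.2];
    functoriality is [C∂.3] for identities and the chain rule [C∂.5]. Strict preservation of
    products holds because projections are additive and commute with ε, so the operations on A × B
    are componentwise, while [C∂.3] gives the derivatives of the projections. *)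

Lemma functor_eq (C D : category) (F G : functor C D) :
  functor_of F = functor_of G -> F = G.
Proof.
by case: F G => [F FP] [G GP] /= FG; subst G; rewrite (proof_irrelevance _ FP GP).
Qed.

Section ChangeActionEquality.
Variable X : cartesian_category.

Lemma pair_ext (C A B : X) (h k : hom C (A × B)) :
  π0 ∘ h = π0 ∘ k -> π1 ∘ h = π1 ∘ k -> h = k.
Proof. by move=> h0 h1; rewrite -[h]pair_eta -[k]pair_eta h0 h1. Qed.

(* Equal action data carry equal change actions, but their types only agree
   propositionally; substituting all operations at once avoids transports. *)
Lemma CAct_span_eq (P Q : change_action X) (A D : X)
    (o o' : hom (A × D) A) (p p' : hom (D × D) D) (z z' : hom ⊤ D)
    (ok : is_change_action (ChangeActionData o p z))
    (ok' : is_change_action (ChangeActionData o' p' z'))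
    (f : hom A (base P)) (df df' : hom (A × D) (delta P))
    (g : hom A (base Q)) (dg dg' : hom (A × D) (delta Q))
    (fP : is_derivative (ChangeActionData o p z) P f df)
    (fP' : is_derivative (ChangeActionData o' p' z') P f df')
    (gP : is_derivative (ChangeActionData o p z) Q g dg)
    (gP' : is_derivative (ChangeActionData o' p' z') Q g dg') :
  o = o' -> p = p' -> z = z' -> df = df' -> dg = dg' ->
  @Span (CAct X) P Q (ChangeAction ok) (CAMap fP) (CAMap gP) =
  @Span (CAct X) P Q (ChangeAction ok') (CAMap fP') (CAMap gP').
Proof.
move=> eo ep ez ef eg; subst o' p' z' df' dg'.
by rewrite (proof_irrelevance _ ok' ok) (proof_irrelevance _ fP' fP)
  (proof_irrelevance _ gP' gP).
Qed.

(** All three operations are maps into [⊤], hence forced. *)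
Lemma CAct_top_eq (o : hom (⊤ × ⊤) (⊤ : X)) (p : hom (⊤ × ⊤) ⊤)
    (z : hom ⊤ ⊤) (ok : is_change_action (ChangeActionData o p z)) :
  ChangeAction ok = ca_top X.
Proof.
have eo := bang_unique o; have ep := bang_unique p; have ez := bang_unique z.
by subst o p z; congr ChangeAction; apply: proof_irrelevance.
Qed.

End ChangeActionEquality.

Section LeftAdditive.
Variable X : cartesian_left_additive_category.

Lemma maddA (A B : X) (f g h : hom A B) : f + (g + h) = (f + g) + h.
Proof. exact: las_addA. Qed.

Lemma maddC (A B : X) (f g : hom A B) : f + g = g + f.
Proof. exact: las_addC. Qed.

Lemma madd0m (A B : X) (f : hom A B) : 0 + f = f.
Proof. exact: las_add0. Qed.

Lemma maddm0 (A B : X) (f : hom A B) : f + 0 = f.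
Proof. by rewrite maddC madd0m. Qed.

Lemma madd_comp (A B C : X) (f g : hom B C) (h : hom A B) :
  (f + g) ∘ h = f ∘ h + g ∘ h.
Proof. exact: las_add_comp. Qed.

Lemma mzero_comp (A B C : X) (f : hom A B) : (0 : hom B C) ∘ f = 0.
Proof. exact: las_zero_comp. Qed.

Lemma proj0_add (C A B : X) (f g : hom C (A × B)) :
  π0 ∘ (f + g) = π0 ∘ f + π0 ∘ g.
Proof. exact: (proj1 (clac_proj0 A B)). Qed.

Lemma proj1_add (C A B : X) (f g : hom C (A × B)) :
  π1 ∘ (f + g) = π1 ∘ f + π1 ∘ g.
Proof. exact: (proj1 (clac_proj1 A B)). Qed.

Lemma proj0_zero (C A B : X) : π0 ∘ (0 : hom C (A × B)) = 0.
Proof. exact: (proj2 (clac_proj0 A B)). Qed.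

Lemma proj1_zero (C A B : X) : π1 ∘ (0 : hom C (A × B)) = 0.
Proof. exact: (proj2 (clac_proj1 A B)). Qed.

End LeftAdditive.

Section Difference.
Variable X : cartesian_difference_category.

Lemma epsD (A B : X) (f g : hom A B) : eps (f + g) = eps f + eps g.
Proof. exact: (eps_add (epsP X)). Qed.

Lemma eps0 (A B : X) : eps (0 : hom A B) = 0.
Proof. exact: (eps_zero (epsP X)). Qed.

Lemma epsM (A B C : X) (g : hom B C) (f : hom A B) : eps g ∘ f = eps (g ∘ f).
Proof. by rewrite (eps_comp (epsP X)). Qed.

(** [E.3] is the case of an identity; [E.2] extends it to every h, since ε(h) = ε(1) ∘ h. *)
Lemma proj0_eps (C A B : X) (h : hom C (A × B)) : π0 ∘ eps h = eps (π0 ∘ h).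
Proof.
by rewrite -epsM (eps_proj0 (epsP X)) compmA epsM comp1m.
Qed.

Lemma proj1_eps (C A B : X) (h : hom C (A × B)) : π1 ∘ eps h = eps (π1 ∘ h).
Proof.
by rewrite -epsM (eps_proj1 (epsP X)) compmA epsM comp1m.
Qed.

(** Together with [catE], this normalises equations between operations to sums of projections under
    [eps]. *)
Definition additiveE := (@madd_comp, @mzero_comp, @proj0_add, @proj1_add,
  @proj0_zero, @proj1_zero, epsM, proj0_eps, proj1_eps).

Lemma alpha_obj_ok (A : X) : is_change_action (alpha_obj A).
Proof.
split; rewrite /= /prod_hom ?(additiveE, @catE) ?eps0 ?maddm0 ?madd0m //.
  by rewrite maddA.
(* The action law: x + ε(y + z) = (x + ε(y)) + ε(z). *)
by rewrite epsD maddA.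
Qed.

Lemma alpha_map_ok (A B : X) (f : hom A B) :
  is_derivative (alpha_obj A) (alpha_obj B) f (diff f).
Proof.
have dP := diffP X.
split=> [C x y|C x y z|C x]; rewrite /= ?(additiveE, @catE).
- exact: (diff_taylor dP).
- exact: (diff_regular_add dP).
- exact: (diff_regular_zero dP).
Qed.

Lemma alpha_is_functor : is_functor (alpha_data alpha_obj_ok alpha_map_ok).
Proof.
split=> [A|A B C g f]; apply: ca_map_eq => //=.
  exact: (diff_id (diffP X)).
exact: (diff_comp (diffP X)).
Qed.

Lemma alpha_preserves_products : preserves_products (Functor alpha_is_functor).
Proof.
split=> [A B|]; last exact: CAct_top_eq.
(* The base objects and base maps of the two spans agree definitionally; what remains is three
   operations, compared by projecting, and the derivatives of the two legs. *)
apply: CAct_span_eq.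
- by apply: pair_ext; rewrite /prod_hom ?(additiveE, @catE).
- by apply: pair_ext; rewrite /prod_hom ?(additiveE, @catE).
- by apply: pair_ext; rewrite ?(additiveE, @catE).
- exact: (diff_proj0 (diffP X)).
- exact: (diff_proj1 (diffP X)).
Qed.

End Difference.

Theorem proposition4p14 (X : cartesian_difference_category) :
  exists (obj_ok : forall A : X, is_change_action (alpha_obj A))
         (map_ok : forall (A B : X) (f : hom A B),
            is_derivative (alpha_obj A) (alpha_obj B) f (diff f))
         (functor_ok : is_functor (alpha_data obj_ok map_ok)),
    is_change_action_model (Functor functor_ok).
Proof.
exists (@alpha_obj_ok X), (@alpha_map_ok X), (alpha_is_functor X).
(* Forgetting after [alpha] is the identity on data by computation, leaving only proofs to
   identify. *)
by split; [exact: alpha_preserves_products | exact: functor_eq].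
Qed.
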